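(* Let $D$ be a regular $(v,k,\lambda,\mu)$-PDS in a finite group $G$ with $0<\mu<k$ and $\sqrt\Delta\in\mathbb{Z}$. Let $p$ be a prime dividing $|G|$ with $p\nmid\sqrt\Delta$, let $\alpha\in\{1,2\}$ be such that $p\in\Pi_\alpha$, and let $\beta$ be the other index. Suppose $p$ divides $|G:G'|$ (the order of the group of linear characters of $G$), and let $P$ be a Sylow $p$-subgroup of $G$. Then $\gcd(|N_G(P)|,\pi_\beta)=1$. Moreover, if $G$ is solvable, then $\pi_\beta\equiv1\pmod p$.
   Context: A $(v,k,\lambda,\mu)$-PDS in a group $G$ of order $v$ is a $k$-subset $D$ such that every nonidentity element of $D$ is $xy^{-1}$ ($x,y\in D$) in exactly $\lambda$ ways and every nonidentity element of $G\setminus D$ in exactly $\mu$ ways; regular means $D=D^{(-1)}$ and $1\notin D$. $\Delta=(\lambda-\mu)^2+4(k-\mu)$, $\theta_{1,2}=\frac12(\lambda-\mu\pm\sqrt\Delta)$. For $i\in\{1,2\}$, $\Pi_i$ is the set of primes $p$ with $p\mid v$, $p\nmid\sqrt\Delta$ and $p\mid k-\theta_i$ (each prime dividing $v$ but not $\sqrt\Delta$ lies in exactly one $\Pi_i$), and $\pi_i=\prod_{p\in\Pi_i}p^{e_p}$ where $p^{e_p}$ is the exact power of $p$ dividing $v$. $G'$ is the derived subgroup. *)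

(* Defs.v *)
From mathcomp Require Import all_boot all_order all_algebra all_fingroup all_solvable.
Set Implicit Arguments. Unset Strict Implicit. Unset Printing Implicit Defensive.
Import GRing.Theory Num.Theory.

Local Open Scope group_scope.

Definition pds_count (gT : finGroupType) (D : {set gT}) (g : gT) : nat :=
  #|[set xy in setX D D | xy.1 * xy.2^-1 == g]|.

Definition is_PDS (gT : finGroupType) (G : {group gT}) (D : {set gT})
  (v k lam mu : nat) : Prop :=
  [/\ D \subset G, #|G| = v, #|D| = k &
      forall g, g \in G -> g != 1 ->
        pds_count D g = (if g \in D then lam else mu)].

Definition regular_set (gT : finGroupType) (D : {set gT}) : Prop :=
  D^-1 = D /\ 1 \notin D.

Local Open Scope ring_scope.

Definition pds_Delta (k lam mu : nat) : int :=
  (lam%:Z - mu%:Z) ^+ 2 + 4 * (k%:Z - mu%:Z).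

(* theta_1 (b = true) and theta_2 (b = false), given s = sqrt Delta.
   The numerator is always even (s and lambda - mu have the same parity when
   s^2 = Delta), so the integer division is exact. *)
Definition pds_theta (lam mu s : nat) (b : bool) : int :=
  if b then ((lam%:Z - mu%:Z + s%:Z) %/ 2)%Z
  else ((lam%:Z - mu%:Z - s%:Z) %/ 2)%Z.

Definition inPi (v k lam mu s : nat) (b : bool) (p : nat) : bool :=
  [&& prime p, (p %| v)%N, ~~ (p %| s)%N &
      (p%:Z %| k%:Z - pds_theta lam mu s b)%Z].

Definition pds_pi (v k lam mu s : nat) (b : bool) : nat :=
  (v`_[pred p | inPi v k lam mu s b p])%N.

(* Main.v *)
(** Put theta = theta_alpha and let sigma be the other eigenvalue minus theta,
so that sigma = s or - s. In Z[G] the element E = D - theta satisfies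
E^2 = sigma E + mu G, hence E^(N+1) is sigma^N E plus a multiple of G, and up to
a factor prime to p the element E - ((k - theta)/v) G is an idempotent over the
integers localised at p. As for any such idempotent, the sum of its coefficients
over a conjugation-stable set C of p-singular elements vanishes, so that
v |D :&: C| = (k - theta) |C|. For the set C of elements whose order is divisible
by some p in Pi_1 and some q in Pi_2 this gives (k - theta_1) |C| =
(k - theta_2) |C|, so C is empty. If an element y of order q in Pi_beta normalises
P, then C_P(y) = 1, whence P = [P, y] lies in G', against p dividing |G : G'|. In
the solvable case P is self-normalising in a Hall subgroup for {p} and Pi_beta, and
Sylow's theorem counts its conjugates. *)
Require Import Defs.
From mathcomp Require Import all_boot all_order all_algebra all_fingroup all_solvable.
From mathcomp Require Import zify ring.
Set Implicit Arguments. Unset Strict Implicit. Unset Printing Implicit Defensive.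
Import GRing.Theory Num.Theory.
Local Open Scope group_scope.

(** * Orbit congruences for weighted words under cyclic rotation *)

Lemma permX_porbit_dvd (T : finType) (f : {perm T}) (x : T) (m : nat) :
  (#|porbit f x| %| m)%N -> (f ^+ m) x = x.
Proof.
case/dvdnP=> c ->; rewrite permX; elim: c => [|c IHc] //=.
by rewrite mulSn iterD IHc iter_porbit.
Qed.

Lemma card_porbit_dvd_order (T : finType) (f : {perm T}) (x : T) :
  (#|porbit f x| %| #[f])%N.
Proof.
have -> : porbit f x = orbit 'P <[f]> x by rewrite porbit.unlock.
by rewrite card_orbit dvdn_indexg.
Qed.

(** All orbits of [f] have [p]-power length. One that contains a point moved by [f ^+ (p ^ m)] has
    length [p ^ i] with [i > m], and [W] is constant on it. *)
Lemma dvdz_sum_nonfixed (T : finType) (f : {perm T}) (W : T -> int) (p n m : nat) :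
  prime p -> f ^+ (p ^ n) = 1 -> (forall t, W (f t) = W t) ->
  ((p ^ m.+1)%N%:Z %| (\sum_(t | (f ^+ (p ^ m))%g t != t) W t)%R)%Z.
Proof.
move=> p_pr fpn Wf.
have Wfi i t : W ((f ^+ i) t) = W t.
  by rewrite permX; elim: i => //= i <-.
rewrite (partition_big (porbit f) predT) //=.
apply: rpred_sum => O _.
case: (pickP (fun t => ((f ^+ (p ^ m)) t != t) && (porbit f t == O)))
  => [t0 /andP[nfix /eqP <-{O}]|none]; last first.
  by rewrite big_pred0 ?dvdz0.
(* Powers of [f] commute, so [f ^+ (p ^ m)] moves every point of the orbit once it moves [t0]. *)
rewrite (eq_bigl (mem (porbit f t0))) => [|t]; last first.
  rewrite -[RHS]/(t \in porbit f t0) -eq_porbit_mem.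
  case: (porbit f t =P _) => [tt0|]; last by rewrite andbF.
  rewrite andbT; have /porbitP[i ->] : t \in porbit f t0 by rewrite -tt0 porbit_id.
  by rewrite -permM -!expgD addnC expgD permM (inj_eq perm_inj).
rewrite (eq_bigr (fun=> W t0)) => [|t /porbitP[i ->] //].
rewrite sumr_const -mulr_natl dvdz_mulr //.
have /(dvdn_pfactor _ _ p_pr)[i _ ci] : (#|porbit f t0| %| p ^ n)%N.
  by apply: dvdn_trans (card_porbit_dvd_order f t0) _; rewrite order_dvdn fpn.
have lt_mi : (m < i)%N.
  rewrite ltnNge; apply: contra nfix => le_im; apply/eqP/permX_porbit_dvd.
  by rewrite ci dvdn_exp2l.
by rewrite ci natz dvdzE /= dvdn_exp2l.
Qed.

(** Comparing prefixes, [t] begins with [w]; cancelling it leaves an equation of the same form, so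
    [t] is [l] copies of [w]. *)
Lemma prodg_comm_pow (gT : finGroupType) (w t : seq gT) (l : nat) :
  size t = (l * size w)%N -> w ++ t = t ++ w ->
  \prod_(x <- t) x = (\prod_(x <- w) x) ^+ l.
Proof.
elim: l t => [|l IHl] t.
  by move/size0nil=> -> _; rewrite big_nil.
rewrite mulSn => szt wt.
have tE : t = w ++ drop (size w) t.
  rewrite -{1}(cat_take_drop (size w) t); congr (_ ++ _).
  have := congr1 (take (size w)) wt.
  by rewrite take_size_cat // takel_cat // szt leq_addr.
rewrite tE big_cat expgS /=; congr (_ * _); apply: IHl.
  by rewrite size_drop szt addKn.
move: wt; rewrite {1 2}tE -catA => /eqP; rewrite eqseq_cat // eqxx /=.
by move/eqP.
Qed.

(** Rotating a word by one letter [a] conjugates its product by [a]. *)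
Lemma prodg_rcons_in (gT : finGroupType) (G : {group gT}) (C : {set gT})
    (a : gT) (t : seq gT) :
  (forall x y, x \in C -> y \in G -> x ^ y \in C) -> a \in G ->
  (\prod_(x <- rcons t a) x \in C) = (\prod_(x <- a :: t) x \in C).
Proof.
move=> CJ aG; rewrite -cats1 big_cat !big_cons big_nil /= mulg1.
set u := \prod_(x <- t) x.
have -> : u * a = (a * u) ^ a by rewrite conjgE mulgA mulKg.
apply/idP/idP => [|/CJ-> //] /CJ/(_ (groupVr aG)).
by rewrite conjgK.
Qed.

Lemma rot_tuple_inj (N : nat) (T : Type) :
  injective (fun t : N.-tuple T => [tuple of seq.rot 1 t]).
Proof. by move=> t u /(congr1 val) /(@rot_inj 1) /val_inj. Qed.

Definition rot_perm (N : nat) (T : finType) : {perm N.-tuple T} :=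
  perm (@rot_tuple_inj N T).

Lemma rot_permX (N : nat) (T : finType) (i : nat) (t : N.-tuple T) :
  (i <= N)%N -> (rot_perm N T ^+ i) t = seq.rot i t :> seq T.
Proof.
rewrite permX; elim: i => [|i IHi] lt_iN /=; first by rewrite rot0.
by rewrite permE /= IHi 1?ltnW // -rotS // size_tuple.
Qed.

(* Cyclic rotation permutes the words of length N = p ^ (m + j) with product in C.
   A word fixed by the rotation by p ^ m has a p ^ j-th power as its product, which
   is p-regular for j large, so it does not occur; all the other rotation orbits have
   length divisible by p ^ m.+1. *)
Lemma dvdz_sum_words (gT : finGroupType) (G : {group gT}) (C : {set gT})
    (w : gT -> int) (p m : nat) :
  prime p -> (forall x, x \notin G -> w x = 0%R) ->
  (forall x y, x \in C -> y \in G -> x ^ y \in C) ->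
  (forall x, x \in C -> (p %| #[x])%N) ->
  exists2 N, (m <= N)%N &
   ((p ^ m)%N%:Z %| (\sum_(t : N.-tuple gT | (\prod_(x <- t) x \in C)%g)
                       \prod_(x <- t) w x)%R)%Z.
Proof.
(* With this [j], the [p]-part of every element order divides [p ^ j]. *)
move=> p_pr w_supp CJ pC; set j := #|gT|; exists (p ^ (m + j))%N.
  apply: leq_trans (leq_addr j m) _; exact/ltnW/ltn_expl/prime_gt1.
set N := (p ^ (m + j))%N.
pose W (t : N.-tuple gT) : int :=
  (if (\prod_(x <- t) x \in C)%g then \prod_(x <- t) w x else 0)%R.
rewrite -/N big_mkcond /= -[X in (_ %| X)%Z]/(\sum_t W t)%R.
have le_mN : (p ^ m <= N)%N by rewrite leq_exp2l ?prime_gt1 ?leq_addr.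
rewrite (bigID (fun t => (rot_perm N gT ^+ (p ^ m)) t != t)) /=.
rewrite [X in (_ + X)%R]big1 ?addr0 => [|t]; last first.
  rewrite negbK => /eqP/(congr1 val); rewrite /= rot_permX // => rt.
  rewrite /W; case: ifP => // /pC.
  rewrite -{1}(cat_take_drop (p ^ m) t) big_cat /=.
  have szw : size (take (p ^ m) t) = (p ^ m)%N by rewrite size_takel ?size_tuple.
  set z := \prod_(x <- take _ _) x.
  (* Rotation by [p ^ m] swaps the prefix with the rest, so invariance says that they commute as
     words; the rest has the length of [p ^ j - 1] prefixes. *)
  rewrite (@prodg_comm_pow _ (take (p ^ m) t) _ (p ^ j).-1); first last.
  - by rewrite cat_take_drop -{1}rt.
  - rewrite szw size_drop size_tuple /N expnD.
    by rewrite -subn1 mulnBl mul1n mulnC.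
  rewrite -/z -expgS prednK ?expn_gt0 ?prime_gt0 // => pz.
  have : p^'.-elt (z ^+ (p ^ j)).
    rewrite p_elt_exp (eq_partn _ (negnK p)) p_part dvdn_exp2l //.
    apply/ltnW/(leq_trans (ltn_logl _ (order_gt0 _))).
    exact: max_card.
  by rewrite /p_elt p'natE // pz.
apply: (@dvdz_trans ((p ^ m.+1)%N%:Z)); first by rewrite dvdzE /= dvdn_exp2l.
apply: (@dvdz_sum_nonfixed _ _ _ _ (m + j)) => // [|t].
  apply/permP=> t; rewrite perm1; apply: val_inj.
  by rewrite /= rot_permX // rot_oversize // size_tuple.
rewrite /W permE /=; case: (t : seq gT) => [|a u] //; rewrite rot1_cons.
(* [C] is stable only under [G], but a word with a letter outside [G] has weight 0 before and after
   rotation. *)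
have [aG|/w_supp wa0] := boolP (a \in G); last first.
  by rewrite -cats1 !big_cat !big_cons !big_nil /= wa0 !(mulr0, mul0r) !if_same.
rewrite (prodg_rcons_in _ CJ) //; case: ifP => // _.
by apply: perm_big; rewrite perm_rcons.
Qed.

(** * Powers of a quasi-idempotent of the integral group ring *)

Local Open Scope ring_scope.

(** Splitting off the first letter is the convolution formula for w^(N+1) = w w^N. *)
Lemma sum_words_cons (gT : finGroupType) (w : gT -> int) (N : nat) (h : gT) :
  \sum_(t : N.+1.-tuple gT | (\prod_(x <- t) x == h)%g) \prod_(x <- t) w x =
  \sum_x w x * \sum_(t : N.-tuple gT | (\prod_(x <- t) x == x^-1 * h)%g)
                 \prod_(y <- t) w y.
Proof.
under [RHS]eq_bigr do rewrite big_distrr.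
rewrite pair_big_dep /=.
rewrite (reindex (fun u : gT * N.-tuple gT => [tuple of u.1 :: u.2])) /=.
  apply: eq_big => [[x t]|[x t] _] /=; last by rewrite big_cons.
  by rewrite big_cons -[RHS](inj_eq (mulgI x)) mulKVg.
exists (fun t : N.+1.-tuple gT => (thead t, [tuple of behead t])) => [[x t] _|t _] /=.
  by congr (_, _); apply: val_inj.
by apply: val_inj; rewrite /= [in RHS](tuple_eta t).
Qed.

(* Here w is an element of the group ring Z[G] with w^2 = sigma w + mu G, and the sum
   over words of length N with product h is the coefficient of h in w^N. *)
Section QuasiIdempotent.

Variables (gT : finGroupType) (G : {group gT}) (w : gT -> int) (sigma mu : int).
Hypothesis w_supp : forall x, x \notin G -> w x = 0.
Hypothesis w_sq : forall h,
  \sum_x w x * w (x^-1 * h)%g = sigma * w h + mu *+ (h \in G).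
Let kappa := \sum_x w x.

Lemma sum_ind_group : \sum_(h : gT) (h \in G)%:R = #|G|%:R :> int.
Proof. by rewrite -sumr_const [RHS]big_mkcond; apply: eq_bigr => h _; case: ifP. Qed.

Lemma augmentation_sq : kappa ^+ 2 = sigma * kappa + mu * #|G|%:R.
Proof.
transitivity (\sum_h \sum_x w x * w (x^-1 * h)%g).
  rewrite exchange_big expr2 big_distrl /=; apply: eq_bigr => x _.
  rewrite -big_distrr /= [in RHS](reindex_inj (mulgI x)).
  by under [in RHS]eq_bigr do rewrite mulKg.
under eq_bigr do rewrite w_sq -mulr_natr.
by rewrite big_split -!big_distrr sum_ind_group.
Qed.

(** The first formula reads w^(N+1) = sigma^N w + c G, and the second is its augmentation with the
    same [c]. *)
Lemma sum_words_closed_form (N : nat) : exists2 c : int,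
  forall h, \sum_(t : N.+1.-tuple gT | (\prod_(x <- t) x == h)%g) \prod_(x <- t) w x =
            sigma ^+ N * w h + c *+ (h \in G)
  & kappa ^+ N.+1 = sigma ^+ N * kappa + c * #|G|%:R.
Proof.
elim: N => [|N [c Sc kc]].
  exists 0 => [h|]; last by rewrite !expr1 expr0 mul1r mul0r addr0.
  rewrite sum_words_cons (bigD1 h) //= (big_pred1 [tuple]) => [|t]; last first.
    by rewrite [t]tuple0 big_nil mulVg !eqxx.
  rewrite big_nil mulr1 big1 ?addr0 ?mul0rn ?addr0 ?expr0 ?mul1r // => x xh.
  rewrite big_pred0 ?mulr0 // => t; rewrite [t]tuple0 big_nil.
  by rewrite -(inj_eq (mulgI x)) mulKVg mulg1 (negPf xh).
(* Multiply sigma^N w + c G by w, using w^2 = sigma w + mu G and w G = kappa G. *)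
exists (sigma ^+ N * mu + kappa * c) => [h|].
  rewrite sum_words_cons; under eq_bigr do rewrite Sc mulrDr mulrCA.
  rewrite big_split -big_distrr /= w_sq mulrDr mulrA -exprSr -addrA; congr (_ + _).
  rewrite mulrnDl mulrnAr; congr (_ + _).
  rewrite -mulrnAl /kappa -mulr_natr !mulr_suml; apply: eq_bigr => x _.
  have [xG|/w_supp->] := boolP (x \in G); last by rewrite !mul0r.
  by rewrite groupMl ?groupV // -[c *+ _]mulr_natr mulrA mulrAC.
rewrite exprS kc [sigma ^+ N.+1]exprS; set u := sigma ^+ N.
transitivity (u * kappa ^+ 2 + kappa * c * #|G|%:R); first by ring.
by rewrite augmentation_sq; ring.
Qed.

(** The difference of the two sides, times a power of [sigma], is divisible by arbitrarily high
    powers of [p]. As [sigma] is prime to [p], the difference is 0. *)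
Lemma sum_singular_class (C : {set gT}) (p : nat) :
  prime p -> (p%:Z %| kappa)%Z -> ~~ (p%:Z %| sigma)%Z -> C \subset G ->
  (forall x y, x \in C -> y \in G -> (x ^ y)%g \in C) ->
  (forall x, x \in C -> (p %| #[x]%g)%N) ->
  #|G|%:R * \sum_(h in C) w h = kappa * #|C|%:R.
Proof.
move=> p_pr pk ps sCG CJ pC; apply/eqP; rewrite -subr_eq0; apply/eqP.
set d := _ - _.
have dvd_d m : ((p ^ m)%N%:Z %| d)%Z.
  (* Asking for [m.+1] instead of [m] rules out words of length 0. *)
  have [[|N] le_mN dvdS] := @dvdz_sum_words gT G C w p m.+1 p_pr w_supp CJ pC; first by [].
  have [c Sc kc] := sum_words_closed_form N.
  set S := (\sum_(t | _) _) in dvdS.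
  have SE : S = sigma ^+ N * (\sum_(h in C) w h) + c * #|C|%:R.
    rewrite /S (partition_big (fun t : N.+1.-tuple gT => (\prod_(x <- t) x)%g) (mem C)) //=.
    rewrite big_distrr /= mulr_natr -sumr_const -big_split; apply: eq_bigr => h hC /=.
    have /= := Sc h; rewrite (subsetP sCG) // mulr1n => <-; apply: eq_bigl => t.
    by case: eqP => [->|]; rewrite ?hC ?andbF.
  (* The unknown [c] is eliminated between [SE] and [kc]. *)
  have dE : sigma ^+ N * d = #|G|%:R * S - kappa ^+ N.+1 * #|C|%:R.
    rewrite SE kc /d; set a := \sum_(h in C) _.
    rewrite mulrBr mulrDr mulrDl !mulrA [#|G|%:R * _]mulrC.
    rewrite [#|G|%:R * c]mulrC opprD addrACA.
    by rewrite subrr addr0.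
  have : ((p ^ m)%N%:Z %| sigma ^+ N * d)%Z.
    apply: (@dvdz_trans (p ^ m.+1)%N%:Z); first by rewrite dvdzE /= dvdn_exp2l.
    rewrite dE; apply: rpredB; [exact: dvdz_mull | apply: dvdz_mulr].
    apply: (@dvdz_trans (p ^ N.+1)%N%:Z); first by rewrite dvdzE /= dvdn_exp2l.
    by rewrite -!natz natrX !natz dvdz_exp2r.
  rewrite Gauss_dvdzr // coprimezE abszX /= coprimeXl // coprimeXr //.
  by rewrite prime_coprime // -dvdzE.
apply/eqP; rewrite -absz_eq0; apply: contraT; rewrite -lt0n => d_gt0.
have := dvd_d `|d|%N; rewrite dvdzE /= => /(dvdn_leq d_gt0).
by rewrite leqNgt ltn_expl // prime_gt1.
Qed.

End QuasiIdempotent.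

(** * Partial difference sets and their eigenvalues *)

Lemma pds_theta_relations (k lam mu s : nat) (b : bool) :
  s%:Z ^+ 2 = pds_Delta k lam mu ->
  [/\ pds_theta lam mu s b + pds_theta lam mu s (~~ b) = lam%:Z - mu%:Z,
      pds_theta lam mu s b * pds_theta lam mu s (~~ b) = mu%:Z - k%:Z
    & pds_theta lam mu s (~~ b) - pds_theta lam mu s b = (-1) ^+ b * s%:Z].
Proof.
rewrite /pds_Delta; set r := lam%:Z - mu%:Z => Ds.
(* [r] and [s] have the same parity because their squares differ by a multiple of 4; this makes the
   halving in [pds_theta] exact. *)
have [q rE] : exists q, r = s%:Z + q * 2.
  have : (2 %| (r - s%:Z) ^+ 2)%Z.
    rewrite (_ : _ ^+ 2 = 2 * (s%:Z ^+ 2 - 2 * (k%:Z - mu%:Z) - r * s%:Z)).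
      exact: dvdz_mulr.
    by rewrite Ds; lia.
  rewrite dvdzE abszX Euclid_dvdX //= => /andP[d _].
  have /dvdzP[q rq] : (2 %| r - s%:Z)%Z by [].
  by exists q; rewrite -rq addrC subrK.
have -> : pds_theta lam mu s b = q + s%:Z *+ b.
  by rewrite /pds_theta -/r rE; case: b => /=; lia.
have -> : pds_theta lam mu s (~~ b) = q + s%:Z *+ ~~ b.
  by rewrite /pds_theta -/r rE; case: b => /=; lia.
rewrite rE in Ds *.
by split; case: b; rewrite /= ?mulr0n ?mulr1n; lia.
Qed.

Lemma pds_autocorrelation (gT : finGroupType) (G : {group gT}) (D : {set gT})
    (v k lam mu : nat) (h : gT) :
  is_PDS G D v k lam mu -> regular_set D ->
  \sum_x ((x \in D)%:R * (x^-1 * h \in D)%g%:R) =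
  k%:Z *+ (h == 1%g) + lam%:Z *+ (h \in D) + mu%:Z *+ [&& h \in G, h != 1%g & h \notin D].
Proof.
move=> [sDG _ kD cD] [DV D1].
have inDV x : (x^-1 \in D)%g = (x \in D) by rewrite -mem_invg DV.
have -> : \sum_x ((x \in D)%:R * (x^-1 * h \in D)%g%:R) = (pds_count D h)%:Z.
  transitivity (#|[set x in D | (x^-1 * h)%g \in D]|%:R : int).
    rewrite -sumr_const [RHS]big_mkcond; apply: eq_bigr => x _ /=.
    by rewrite inE -natrM mulnb; case: (_ && _).
  rewrite -natz -(card_imset _ (_ : injective (fun x => (x, h^-1 * x)%g))); last by move=> x y [].
  congr (#|pred_of_set _|%:R); apply/setP=> [[x y]]; rewrite !inE /=.
  (* Since D is closed under inversion, x^-1 h and its inverse h^-1 x lie in D together, so products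
     and quotients give the same count. *)
  have inDh : ((x^-1 * h)%g \in D) = ((h^-1 * x)%g \in D).
    by rewrite -inDV invMg invgK.
  apply/imsetP/andP => [[u] | [/andP[xD yD] /eqP hE]].
    rewrite inE => /andP[uD uh] [-> ->]; rewrite uD invMg invgK mulKVg eqxx.
    by rewrite -inDV invMg invgK uh.
  exists x; first by rewrite inE xD inDh -hE invMg invgK mulgKV.
  by rewrite -hE invMg invgK mulgKV.
have [-> | h1] := eqVneq h 1%g.
  rewrite (negPf D1) andbF mulr1n !mulr0n !addr0 -kD /pds_count; congr Posz.
  rewrite -(card_imset D (_ : injective (fun x => (x, x)))); last by move=> x y [].
  apply: eq_card => [[x y]]; rewrite !inE /= -eq_mulgV1.
  apply/andP/imsetP => [[/andP[xD _] /eqP <-]|[u uD [-> ->]]]; first by exists x.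
  by rewrite uD eqxx.
have [hG|hG] := boolP (h \in G); last first.
  rewrite (contraNF (subsetP sDG h) hG) !addr0; apply/eqP.
  rewrite eqz_nat cards_eq0; apply: contraNT hG => /set0Pn[[x y]].
  by rewrite !inE /= => /andP[/andP[xD yD] /eqP <-]; rewrite groupM ?groupV ?(subsetP sDG).
by rewrite cD //; case: (h \in D); rewrite ?mulr0n ?mulr1n ?add0r ?addr0.
Qed.

Lemma pds_singular_class (gT : finGroupType) (G : {group gT}) (D C : {set gT})
    (v k lam mu s p : nat) (b : bool) :
  is_PDS G D v k lam mu -> regular_set D ->
  s%:Z ^+ 2 = pds_Delta k lam mu ->
  inPi v k lam mu s b p -> C \subset G ->
  (forall x y, x \in C -> y \in G -> (x ^ y)%g \in C) ->
  (forall x, x \in C -> (p %| #[x]%g)%N) ->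
  (v * #|D :&: C|)%N%:Z = (k%:Z - pds_theta lam mu s b) * #|C|%:Z.
Proof.
move=> pdsD regD Ds /and4P[p_pr _ ps pk] sCG CJ pC.
have [sDG vG kD _] := pdsD; have [_ D1] := regD.
have [tS tM tB] := pds_theta_relations b Ds.
set th := pds_theta _ _ _ b in tS tM tB pk *.
set th' := pds_theta _ _ _ _ in tS tM tB.
pose w (x : gT) : int := (x \in D)%:R - th *+ (x == 1%g).
have w_sum (A : {set gT}) : \sum_(x in A) w x = #|D :&: A|%:R - th *+ (1%g \in A).
  rewrite sumrB; congr (_ - _).
    rewrite -sumr_const big_mkcond [RHS]big_mkcond; apply: eq_bigr => x _ /=.
    by rewrite inE andbC; case: (x \in A); case: (x \in D).
  rewrite big_mkcond (bigD1 1%g) //= eqxx mulr1n big1 ?addr0 => [|x /negPf->].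
    by case: ifP.
  by rewrite mulr0n if_same.
have w_supp x : x \notin G -> w x = 0.
  move=> xG; rewrite /w (contraNF (subsetP sDG x) xG).
  by case: eqP xG => [->|]; rewrite ?group1 // mulr0n subr0.
have w_sq h : \sum_x w x * w (x^-1 * h)%g = (th' - th) * w h + mu%:Z *+ (h \in G).
  (* Expand w^2 as D^2 - theta D - theta w; the coefficients of D^2 come from
     [pds_autocorrelation]. *)
  transitivity (\sum_x ((x \in D)%:R * (x^-1 * h \in D)%g%:R)
                - th * (h \in D)%:R - th * w h : int).
    have wE : forall x, w x * w (x^-1 * h)%g =
       (x \in D)%:R * (x^-1 * h \in D)%g%:R
       - th * ((x \in D)%:R *+ (x == h)) - th * (w h *+ (x == 1%g)).
      move=> x; rewrite /w -eq_mulVg1.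
      have [->|_] := eqVneq x 1%g; last by rewrite !mulr0n; case: (x == h) => /=; ring.
      rewrite invg1 mul1g [1%g == h]eq_sym; case: (h == 1%g) => /=; ring.
    under eq_bigr do rewrite wE.
    rewrite !sumrB -!big_distrr /=; congr (_ - th * _ - th * _).
      by rewrite (bigD1 h) //= eqxx big1 ?addr0 // => x /negPf->.
    by rewrite (bigD1 1%g) //= eqxx big1 ?addr0 // => x /negPf->.
  rewrite (pds_autocorrelation _ pdsD regD) /w.
  have [->|h1] := eqVneq h 1%g.
    rewrite group1 (negPf D1) /=; lia.
  have [hD|hD] := boolP (h \in D); first by rewrite (subsetP sDG) //=; lia.
  by case: (h \in G) => /=; lia.
have kE : \sum_x w x = k%:Z - th.
  transitivity (\sum_(x in [set: gT]) w x); first by apply: eq_bigl => x; rewrite inE.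
  by rewrite w_sum setIT kD inE natz.
have C1 : (1%g \in C) = false by apply/negP=> /pC; rewrite order1 Euclid_dvd1.
have := sum_singular_class w_supp w_sq p_pr _ _ sCG CJ pC.
rewrite kE w_sum vG tB C1 subr0 -natrM !natz; apply=> //.
by rewrite dvdzE abszMsign.
Qed.

(** A prime in both sets would divide the difference of the two eigenvalues, which is [s] up to
    sign. *)
Lemma inPi_inj (v k lam mu s p : nat) (b c : bool) :
  s%:Z ^+ 2 = pds_Delta k lam mu ->
  inPi v k lam mu s b p -> inPi v k lam mu s c p -> b = c.
Proof.
move=> Ds /and4P[_ _ ps pb] /and4P[_ _ _ pc]; have [//|neq_bc] := eqVneq b c.
have cE : c = ~~ b by case: (b) (c) neq_bc => [] [].
have [_ _ tB] := pds_theta_relations b Ds.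
case/negP: ps; have := rpredB pb pc; rewrite cE [X in X \in _](_ : _ = (-1) ^+ b * s%:Z).
  by rewrite dvdzE abszMsign.
by rewrite -tB; ring.
Qed.

Lemma pds_no_mixed_order (gT : finGroupType) (G : {group gT}) (D : {set gT})
    (v k lam mu s p q : nat) (b : bool) (x : gT) :
  is_PDS G D v k lam mu -> regular_set D -> s%:Z ^+ 2 = pds_Delta k lam mu ->
  inPi v k lam mu s b p -> inPi v k lam mu s (~~ b) q ->
  x \in G -> ~~ ((p %| #[x]%g) && (q %| #[x]%g))%N.
Proof.
move=> pdsD regD Ds Pp Pq xG; apply/negP=> pqx.
pose C := [set y in G | (p %| #[y]%g) && (q %| #[y]%g)]%N.
have sCG : C \subset G by apply/subsetP=> y /setIdP[].
have CJ y z : y \in C -> z \in G -> (y ^ z)%g \in C.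
  by rewrite !inE => /andP[yG yC] zG; rewrite groupJ // orderJ.
have pC y : y \in C -> (p %| #[y]%g)%N by rewrite inE => /and3P[].
have qC y : y \in C -> (q %| #[y]%g)%N by rewrite inE => /and3P[].
have := pds_singular_class pdsD regD Ds Pp sCG CJ pC.
rewrite (pds_singular_class pdsD regD Ds Pq sCG CJ qC).
have C0 : #|C|%:Z != 0.
  by rewrite eqz_nat cards_eq0; apply/set0Pn; exists x; rewrite inE xG.
move=> /(mulIf C0)/eqP; rewrite -subr_eq0.
have [_ _ tB] := pds_theta_relations b Ds.
have /and4P[_ _ ps _] := Pp.
rewrite [X in X == 0](_ : _ = - ((-1) ^+ b * s%:Z)); last by rewrite -tB; ring.
rewrite oppr_eq0 mulf_eq0 signr_eq0 /= => /eqP[s0].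
by rewrite s0 dvdn0 in ps.
Qed.

(* Coprime action and Sylow counting *)
Local Close Scope ring_scope.

(** Put H = P :&: G'. Since [P, y] lies in H, [y] centralises P / H. If C_P(y) = 1, coprime action
    makes the fixed points of [y] on P / H trivial, so P lies in G' and |G : G'| is prime to [p]. *)
Lemma coprime_norm_cent_sylow (gT : finGroupType) (G P : {group gT}) (p : nat) (y : gT) :
  prime p -> p.-Sylow(G) P -> (p %| #|G : G^`(1)|)%N ->
  y \in 'N_G(P) -> coprime p #[y] ->
  exists2 x, x \in P & #[x] = p /\ commute x y.
Proof.
move=> p_pr sylP pG' /setIP[yG nPy] co_py.
have [sPG pP _] := and3P sylP.
have CP_neq1 : 'C_P(<[y]>) != 1.
  apply: contraL pG' => /eqP CP1.
  have coPy : coprime #|P| #|<[y]>|.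
    by have [n ->] := p_natP pP; rewrite coprimeXl.
  set H := (P :&: G^`(1))%G.
  have nHy : <[y]> \subset 'N(H).
    rewrite cycle_subG; apply: (subsetP (normsI (subsetIl 'N(P) G) _)).
      exact: subset_trans (subsetIr _ _) (der_norm 1 G).
    by rewrite inE nPy.
  have := coprime_quotient_cent (subsetIl _ _ : H \subset P) nHy coPy (pgroup_sol pP).
  rewrite CP1 quotient1 => CPH1.
  have sPH : P \subset H.
    rewrite -quotient_sub1; last by rewrite normsI ?normG // (subset_trans sPG) ?der_norm.
    rewrite CPH1 subsetI subxx quotient_cents2r //.
    rewrite subsetI commg_subl cycle_subG nPy.
    by apply: (commgSS sPG); rewrite cycle_subG.
  have sPG' : P \subset G^`(1) by apply: subset_trans sPH (subsetIr _ _).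
  rewrite -p'natE //; apply: pnat_dvd (indexgS G sPG') _.
  by case/and3P: sylP.
have [_ p_dvd _] := pgroup_pdiv (pgroupS (subsetIl _ _) pP) CP_neq1.
have [x /setIP[xP cxy] ox] := Cauchy p_pr p_dvd.
exists x => //; split=> //; apply/cent1P.
by rewrite -cent_cycle.
Qed.

(* alpha = true means index 1, false means index 2; beta = ~~ alpha. *)
Theorem mainTheorem11 (gT : finGroupType) (G : {group gT}) (D : {set gT})
  (v k lam mu s p : nat) (alpha : bool) (P : {group gT}) :
  is_PDS G D v k lam mu ->
  regular_set D ->
  (0 < mu < k)%N ->
  ((s%:Z) ^+ 2 = pds_Delta k lam mu)%R ->
  prime p -> (p %| #|G|)%N -> ~~ (p %| s)%N ->
  inPi v k lam mu s alpha p ->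
  (p %| #|G : G^`(1)|%g)%N ->
  P \in 'Syl_p(G) ->
  coprime #|'N_G(P)| (pds_pi v k lam mu s (~~ alpha)) /\
  (solvable G -> pds_pi v k lam mu s (~~ alpha) = 1 %[mod p]).
Proof.
move=> pdsD regD _ Ds p_pr pG ps Pp pG'; set beta := ~~ alpha.
have vG : #|G| = v by case: pdsD.
pose Pib := [pred q | inPi v k lam mu s beta q].
have p_notin : p \notin Pib.
  by rewrite inE; apply/negP=> /(inPi_inj Ds Pp); rewrite /beta => /eqP; case: (alpha).
have coprimeN (R : {group gT}) :
  p.-Sylow(G) R -> coprime #|'N_G(R)| (pds_pi v k lam mu s beta).
  move=> sylR; apply: p'nat_coprime (part_pnat Pib v).
  apply/pnatP=> // q q_pr qN; apply/negP=> Pq.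
  have [y yN oy] := Cauchy q_pr qN.
  have co_py : coprime p #[y].
    rewrite oy prime_coprime // dvdn_prime2 //.
    by apply: contra p_notin => /eqP->.
  have [x xR [ox cxy]] := coprime_norm_cent_sylow p_pr sylR pG' yN co_py.
  (* The orders of the commuting [x] and [y] are the distinct primes [p] and [q], so [x * y] has the
     excluded order [p * q]. *)
  have xyG : x * y \in G.
    by apply: groupM; [exact: (subsetP (pHall_sub sylR)) | case/setIP: yN].
  case/negP: (pds_no_mixed_order pdsD regD Ds Pp Pq xyG).
  by rewrite orderM ?ox // oy dvdn_mulr ?dvdn_mull.
rewrite inE => sylP; split; first exact: coprimeN.
move=> solG; have [K hallK] := Hall_exists [predU1 p & Pib] solG.
have [sKG _ _] := and3P hallK.
have [R sylRK] := Sylow_exists p K.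
have sylR : p.-Sylow(G) R.
  apply: subHall_Sylow hallK _ sylRK; exact: predU1l.
(* Only [p] and primes of [Pib] can divide |N_K(R)|, and [coprimeN] rules out the latter; so N_K(R)
   is a [p]-group containing the Sylow subgroup [R]. *)
have NKR : 'N_K(R) = R.
  have sNK : 'N_K(R) \subset K := subsetIl _ _.
  apply: (sub_pHall sylRK) => //; last first.
    by rewrite subsetI normG (pHall_sub sylRK).
  have piN := pgroupS sNK (pHall_pgroup hallK).
  apply/pgroupP=> q q_pr qN.
  have /orP[//|Pq] : q \in [predU1 p & Pib] by apply: (pgroupP piN).
  have co_q : coprime q (pds_pi v k lam mu s beta).
    by apply: coprime_dvdl (coprimeN R sylR); apply: dvdn_trans qN (cardSg (setSI _ sKG)).
  move: co_q; rewrite prime_coprime // => /negP[].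
  have qv : (q %| v)%N by case/and4P: Pq.
  have v_gt0 : (0 < v)%N by rewrite -vG.
  have qPib : Pib.-nat q by rewrite pnatE.
  by rewrite -(part_pnat_id qPib) partn_dvd.
have KR : #|K : R| = pds_pi v k lam mu s beta.
  apply/eqP; rewrite -(eqn_pmul2l (cardG_gt0 R)) Lagrange ?(pHall_sub sylRK) //.
  rewrite (card_Hall sylRK) -[X in X == _](partnC p (cardG_gt0 K)) eqn_pmul2l ?part_gt0 //.
  rewrite (card_Hall hallK) vG -partnI; apply/eqP/eq_partn => q.
  move: p_notin; rewrite !inE; case: eqP => [->|_] /=; last by rewrite andbT.
  by move/negPf.
(* The number of Sylow [p]-subgroups of [K] is |K : N_K(R)| = |K : R|, which is the [Pib]-part of
   [v]. *)
have := card_Syl_mod K p_pr; rewrite (card_Syl sylRK) NKR KR => ->.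
by rewrite modn_small ?prime_gt1.
Qed.
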